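(* Let $f:\mathbb{E}_1^n\to\mathbb{E}_1^n$, $f(x)=\mu\mathbf{A}x+\mathbf{b}$, be a p-similarity of the Minkowski $n$-space, with associated linear map $\vec f(\mathbf{u})=\mu\mathbf{A}\mathbf{u}$. Then $f$ preserves causal characters and angles. That is: (1) for every vector $\mathbf{u}$, the vector $\vec f(\mathbf{u})$ has the same causal character (spacelike, timelike or null) as $\mathbf{u}$; (2) whenever $\mathbf{u},\mathbf{v}$ are two vectors between which an angle $\theta$ is defined (of type (i), (ii) or (iii) of the context), the angle between $\vec f(\mathbf{u})$ and $\vec f(\mathbf{v})$ is defined, is of the same type, and equals $\theta$.
   Context: $\mathbb{E}_1^n$ is $\mathbb{R}^n$ with the Lorentzian inner product $\mathbf{x}\cdot\mathbf{y}=\mathbf{x}^T I^*\mathbf{y}$, $I^*=\mathrm{diag}(-1,1,\dots,1)$, and $\|\mathbf{x}\|=\sqrt{|\mathbf{x}\cdot\mathbf{x}|}$. A p-similarity (pseudo-similarity) of $\mathbb{E}_1^n$ is a map $f(x)=\mu\mathbf{A}x+\mathbf{b}$, where $\mu$ is a non-zero real constant, $\mathbf{A}$ is a fixed pseudo-orthogonal $n\times n$ matrix (i.e. $\mathbf{A}^TI^*\mathbf{A}=I^*$) with $\det\mathbf{A}=1$, and $\mathbf{b}\in\mathbb{R}^n$ is a translation vector. Angles: (i) if $\mathbf{x},\mathbf{y}$ are timelike vectors in the same timecone, the hyperbolic angle between them is the unique $\theta\ge 0$ with $\mathbf{x}\cdot\mathbf{y}=-\|\mathbf{x}\|\|\mathbf{y}\|\cosh\theta$;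 (ii) if $\mathbf{x},\mathbf{y}$ are spacelike with $|\mathbf{x}\cdot\mathbf{y}|<\|\mathbf{x}\|\|\mathbf{y}\|$, the angle is the $\theta\in[0,\pi]$ with $\mathbf{x}\cdot\mathbf{y}=\|\mathbf{x}\|\|\mathbf{y}\|\cos\theta$; (iii) if $\mathbf{x},\mathbf{y}$ are spacelike with $|\mathbf{x}\cdot\mathbf{y}|>\|\mathbf{x}\|\|\mathbf{y}\|$, the hyperbolic angle is the $\theta\ge0$ with $\mathbf{x}\cdot\mathbf{y}=\|\mathbf{x}\|\|\mathbf{y}\|\cosh\theta$ (when it exists). *)

(* Defs.v *)
From HB Require Import structures.
From mathcomp Require Import all_boot all_order all_algebra.
From mathcomp Require Import reals sequences exp trigo.

Set Implicit Arguments.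
Unset Strict Implicit.
Unset Printing Implicit Defensive.

Import Order.TTheory GRing.Theory Num.Theory.
Local Open Scope ring_scope.

(* Minkowski space of dimension n.+1; the time axis is coordinate ord0. *)
Section Minkowski.
Variables (R : realType) (n : nat).
Implicit Types (x y u v b : 'cV[R]_n.+1) (A : 'M[R]_n.+1) (mu theta : R).

Definition lorentz_mx : 'M[R]_n.+1 :=
  diag_mx (\row_i (if i == ord0 then -1 else 1)).

Definition lorentz x y : R := (x^T *m lorentz_mx *m y) ord0 ord0.

Definition lnorm x : R := Num.sqrt `|lorentz x x|.

Definition pseudo_orthogonal A : Prop := A^T *m lorentz_mx *m A = lorentz_mx.

Definition is_p_similarity mu A b (f : 'cV[R]_n.+1 -> 'cV[R]_n.+1) : Prop :=
  [/\ mu != 0, pseudo_orthogonal A, \det A = 1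
    & forall x, f x = mu *: (A *m x) + b].

Definition linear_part mu A u : 'cV[R]_n.+1 := mu *: (A *m u).

(* The zero vector counts as spacelike, so that each vector has exactly one
   causal character. *)
Definition spacelike x : bool := (0 < lorentz x x) || (x == 0).
Definition timelike x : bool := lorentz x x < 0.
Definition null x : bool := (lorentz x x == 0) && (x != 0).

(* The two timecones are the two connected components of the set of timelike
   vectors, told apart by the sign of the time coordinate. *)
Definition future_timecone x : bool := timelike x && (0 < x ord0 ord0).
Definition past_timecone x : bool := timelike x && (x ord0 ord0 < 0).
Definition same_timecone x y : bool :=
  (future_timecone x && future_timecone y) ||
  (past_timecone x && past_timecone y).

Definition cosh (t : R) : R := (expR t + expR (- t)) / 2.

Inductive angle_type : Set :=
  TimelikeAngle | SpacelikeCircularAngle | SpacelikeHyperbolicAngle.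

(* [is_angle k x y theta]: an angle of type k between x and y is defined and
   theta is its value. *)
Definition is_angle (k : angle_type) x y theta : Prop :=
  match k with
  | TimelikeAngle =>
      [/\ timelike x && timelike y, same_timecone x y, 0 <= theta
        & lorentz x y = - (lnorm x * lnorm y * cosh theta)]
  | SpacelikeCircularAngle =>
      [/\ spacelike x && spacelike y, `|lorentz x y| < lnorm x * lnorm y,
          0 <= theta, theta <= pi
        & lorentz x y = lnorm x * lnorm y * cos theta]
  | SpacelikeHyperbolicAngle =>
      [/\ spacelike x && spacelike y, lnorm x * lnorm y < `|lorentz x y|,
          0 <= theta
        & lorentz x y = lnorm x * lnorm y * cosh theta]
  end.

End Minkowski.

(* Main.v *)
Require Import Defs.
From mathcomp Require Import all_boot all_order all_algebra.
From mathcomp Require Import reals sequences exp trigo.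
From mathcomp Require Import ring lra.

Set Implicit Arguments.
Unset Strict Implicit.
Unset Printing Implicit Defensive.

Import Order.TTheory GRing.Theory Num.Theory.

Local Open Scope ring_scope.

(** The linear part scales the Lorentzian product by [mu ^+ 2], hence norms by
    [`|mu|], so all conditions on products and norms are invariant. Only the
    timecones are not visibly expressed by products: two timelike vectors lie
    in the same timecone iff their product is negative, because
    [y0 x - x0 y] has no time component, so that
    [0 <= y0^2 (x.x) - 2 x0 y0 (x.y) + x0^2 (y.y)] and [x0 y0 (x.y) < 0]. *)

Section LorentzProduct.
Variables (R : realType) (n : nat).
Implicit Types (x y z u v : 'cV[R]_n.+1) (A : 'M[R]_n.+1) (a mu theta : R).

Lemma lorentzDl x y z : lorentz (x + y) z = lorentz x z + lorentz y z.
Proof. by rewrite /lorentz linearD /= !mulmxDl mxE. Qed.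

Lemma lorentzDr x y z : lorentz x (y + z) = lorentz x y + lorentz x z.
Proof. by rewrite /lorentz mulmxDr mxE. Qed.

Lemma lorentzZl a x y : lorentz (a *: x) y = a * lorentz x y.
Proof. by rewrite /lorentz linearZ /= -!scalemxAl mxE. Qed.

Lemma lorentzZr a x y : lorentz x (a *: y) = a * lorentz x y.
Proof. by rewrite /lorentz -scalemxAr mxE. Qed.

Lemma lorentz0 : lorentz (0 : 'cV[R]_n.+1) 0 = 0.
Proof. by rewrite -(scale0r 0) lorentzZl mul0r. Qed.

Lemma lorentzC x y : lorentz x y = lorentz y x.
Proof.
(* The one-by-one product is read as a trace, which transposition preserves; [lorentz_mx], being
   diagonal, is its own transpose. *)
rewrite /lorentz -[in LHS](mulmxA x^T) -[in LHS]trace_mx11 -mxtrace_tr.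
by rewrite !trmx_mul trmxK /lorentz_mx tr_diag_mx trace_mx11.
Qed.

Lemma lorentz_space_ge0 x : x ord0 ord0 = 0 -> 0 <= lorentz x x.
Proof.
move=> x0; rewrite /lorentz /lorentz_mx mul_mx_diag mxE.
apply: sumr_ge0 => i _; rewrite !mxE.
have [->|_] := eqVneq i ord0; first by rewrite x0 mulr0.
by rewrite mulr1 -expr2 sqr_ge0.
Qed.

Lemma timelike_time_neq0 x : timelike x -> x ord0 ord0 != 0.
Proof. by apply: contraTneq => /lorentz_space_ge0; rewrite /timelike -leNgt. Qed.

Lemma lorentz_time_lt0 x y : timelike x -> timelike y ->
  x ord0 ord0 * y ord0 ord0 * lorentz x y < 0.
Proof.
move=> tx ty; set p := x ord0 ord0; set q := y ord0 ord0.
have := @lorentz_space_ge0 (q *: x + (- p) *: y).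
rewrite !mxE lorentzDl !lorentzDr !lorentzZl !lorentzZr (lorentzC y x).
move=> /(_ ltac:(rewrite -/p -/q; ring)) h.
have p2 : 0 < p ^+ 2 by rewrite exprn_even_gt0 // timelike_time_neq0.
have q2 : 0 < q ^+ 2 by rewrite exprn_even_gt0 // timelike_time_neq0.
have hx : q ^+ 2 * lorentz x x < 0 by rewrite pmulr_rlt0.
have hy : p ^+ 2 * lorentz y y < 0 by rewrite pmulr_rlt0.
lra.
Qed.

Lemma same_timecone_lorentz x y :
  same_timecone x y = [&& timelike x, timelike y & lorentz x y < 0].
Proof.
rewrite /same_timecone /future_timecone /past_timecone.
case tx: (timelike x) => //=; case ty: (timelike y) => //=; last by rewrite !andbF.
have h := lorentz_time_lt0 tx ty.
have := timelike_time_neq0 tx; have := timelike_time_neq0 ty.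
(* When the time coordinates have equal signs, both sides are true; when the signs differ, [h] makes
   the product positive and both sides are false. *)
rewrite !neq_lt => /orP[] hy /orP[] hx.
- by move: h; rewrite hx hy orbT pmulr_rlt0 ?nmulr_rgt0.
- move: h; rewrite hx hy (lt_gtF hx) (lt_gtF hy) /= nmulr_rlt0 ?pmulr_rlt0 //.
  by move=> h; rewrite ltNge ltW.
- move: h; rewrite hx hy (lt_gtF hx) (lt_gtF hy) /= nmulr_rlt0 ?nmulr_rlt0 //.
  by move=> h; rewrite ltNge ltW.
- by move: h; rewrite hx hy pmulr_rlt0 ?mulr_gt0.
Qed.

Lemma timelike_spacelikeF x : timelike x -> spacelike x = false.
Proof.
rewrite /timelike /spacelike => h; rewrite ltNge (ltW h) /=.
by apply: contraTF h => /eqP ->; rewrite lorentz0 ltxx.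
Qed.

Lemma lnorm_timelike_gt0 x : timelike x -> 0 < lnorm x.
Proof. by rewrite /timelike sqrtr_gt0 normr_gt0 => /lt_eqF ->. Qed.

(** Twice the difference [cosh t - cosh s] factors as [(expR t - expR s) * (1 - expR (- s) * expR (-
    t))], and both factors are positive because [s < t] and [0 < s + t]. *)
Lemma cosh_lt : {in Num.nneg &, {homo @cosh R : s t / s < t}}.
Proof.
move=> s t; rewrite !nnegrE => s0 _ lt_st; rewrite ltr_pM2r ?invr_gt0 //.
have expRMN c : expR c * expR (- c) = 1 :> R by rewrite -expRD subrr expR0.
have es := expRMN s; have et := expRMN t.
have lt_est : expR s < expR t by rewrite ltr_expR.
have lt1 : expR (- s) * expR (- t) < 1.
  by rewrite -expRD -expR0 ltr_expR -opprD oppr_lt0; lra.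
have : expR (- s) * expR (- t) * (expR t - expR s) < expR t - expR s.
  by rewrite gtr_pMl // subr_gt0.
(* The left-hand side cancels to [expR (- s) - expR (- t)]. *)
rewrite mulrBr -mulrA (mulrC (expR (- t))) et mulrAC (mulrC (expR (- s)) (expR s)).
by rewrite es; lra.
Qed.

Lemma cosh_inj : {in Num.nneg &, injective (@cosh R)}.
Proof.
move=> s t s0 t0 e; case: (ltgtP s t) => // h.
- by have := cosh_lt s0 t0 h; rewrite e ltxx.
- by have := cosh_lt t0 s0 h; rewrite e ltxx.
Qed.

(** Causal character separates the timelike type from the other two, which are told apart by
    opposite strict inequalities. Within one type, the nonzero product of norms cancels, and [cosh]
    is injective on nonnegative reals, [cos] on [[0, pi]]. *)
Lemma is_angle_unique k k' x y theta theta' :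
  is_angle k x y theta -> is_angle k' x y theta' -> k' = k /\ theta' = theta.
Proof.
case: k k' => -[] /= [] /andP[cx cy].
- move=> _ t0 e [_ _ t'0]; rewrite e => /oppr_inj/mulfI/cosh_inj h.
  by split=> //; apply/esym/h; rewrite ?nnegrE // gt_eqF ?mulr_gt0 ?lnorm_timelike_gt0.
- by move=> _ _ _ [/andP[]]; rewrite timelike_spacelikeF.
- by move=> _ _ _ [/andP[]]; rewrite timelike_spacelikeF.
- by move=> _ _ _ _ [/andP[/timelike_spacelikeF]]; rewrite cx.
- move=> lt t0 tpi e [_ _ t'0 t'pi]; rewrite e => /mulfI/cos_inj h.
  split=> //; apply/esym/h; rewrite ?in_itv /= ?t0 ?t'0 //.
  by rewrite gt_eqF // (le_lt_trans _ lt).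
- by move=> lt _ _ _ [_ /(lt_trans lt)]; rewrite ltxx.
- by move=> _ _ _ [/andP[/timelike_spacelikeF]]; rewrite cx.
- by move=> lt _ _ [_ /(lt_trans lt)]; rewrite ltxx.
- move=> lt t0 e [_ _ t'0]; rewrite e => /mulfI/cosh_inj h.
  split=> //; apply/esym/h; rewrite ?nnegrE //.
  (* A spacelike vector may be zero, so the norms alone do not give a nonzero product; if it
     vanished, [e] would turn [lt] into [0 < 0]. *)
  by apply: contraTneq lt => n0; rewrite e n0 mul0r normr0 ltxx.
Qed.

Variables (mu : R) (A : 'M[R]_n.+1).
Hypotheses (mu_neq0 : mu != 0) (A_po : pseudo_orthogonal A) (detA : \det A = 1).
Local Notation F := (linear_part mu A).

Lemma lorentz_linear_part u v : lorentz (F u) (F v) = mu ^+ 2 * lorentz u v.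
Proof.
rewrite /linear_part lorentzZl lorentzZr mulrA -expr2; congr (_ * _).
by rewrite /lorentz trmx_mul -[in RHS]A_po !mulmxA.
Qed.

Lemma lnorm_linear_part u : lnorm (F u) = `|mu| * lnorm u.
Proof.
by rewrite /lnorm lorentz_linear_part normrM normrX sqrtrM ?sqr_ge0 // sqrtr_sqr normr_id.
Qed.

(** Needed because [spacelike] and [null] single out the zero vector; it rests on the invertibility
    of [A]. *)
Lemma linear_part_eq0 u : (F u == 0) = (u == 0).
Proof.
rewrite /linear_part scaler_eq0 (negbTE mu_neq0) /=.
apply/eqP/eqP => [Au0|->]; last by rewrite mulmx0.
have uA : A \in unitmx by rewrite unitmxE detA unitr1.
by rewrite -(mulKmx uA u) Au0 mulmx0.
Qed.

Lemma sqr_mu_gt0 : 0 < mu ^+ 2.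
Proof. by rewrite exprn_even_gt0. Qed.

Lemma spacelike_linear_part u : spacelike (F u) = spacelike u.
Proof.
by rewrite /spacelike lorentz_linear_part linear_part_eq0 pmulr_rgt0 ?sqr_mu_gt0.
Qed.

Lemma timelike_linear_part u : timelike (F u) = timelike u.
Proof. by rewrite /timelike lorentz_linear_part pmulr_rlt0 ?sqr_mu_gt0. Qed.

Lemma null_linear_part u : null (F u) = null u.
Proof.
by rewrite /null lorentz_linear_part linear_part_eq0 mulf_eq0 gt_eqF ?sqr_mu_gt0.
Qed.

(** Both vectors may move to the opposite cone, as for [mu < 0] and [A] the identity; the sign of
    their product does not change. *)
Lemma same_timecone_linear_part u v :
  same_timecone (F u) (F v) = same_timecone u v.
Proof.
rewrite !same_timecone_lorentz !timelike_linear_part lorentz_linear_part.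
by rewrite pmulr_rlt0 ?sqr_mu_gt0.
Qed.

(** The factor is the one by which the Lorentzian product scales, so it cancels from every condition
    in [is_angle]. *)
Lemma lnormM_linear_part u v :
  lnorm (F u) * lnorm (F v) = mu ^+ 2 * (lnorm u * lnorm v).
Proof. by rewrite !lnorm_linear_part mulrACA -normrM -expr2 ger0_norm ?sqr_ge0. Qed.

Lemma is_angle_linear_part k u v theta :
  is_angle k u v theta -> is_angle k (F u) (F v) theta.
Proof.
have m0 := sqr_mu_gt0.
case: k => /= -[]; rewrite ?timelike_linear_part ?spacelike_linear_part
  ?same_timecone_linear_part lnormM_linear_part lorentz_linear_part.
- by move=> ? ? ? ->; split=> //; rewrite mulrN !mulrA.
- move=> ? h ? ? e; split=> //; last by rewrite e !mulrA.
  by rewrite normrM (gtr0_norm m0) ltr_pM2l.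
- move=> ? h ? e; split=> //; last by rewrite e !mulrA.
  by rewrite normrM (gtr0_norm m0) ltr_pM2l.
Qed.

End LorentzProduct.

Theorem theorem2 (R : realType) (n : nat)
    (f : 'cV[R]_n.+1 -> 'cV[R]_n.+1)
    (mu : R) (A : 'M[R]_n.+1) (b : 'cV[R]_n.+1)
    (hf : is_p_similarity mu A b f) :
  (forall u : 'cV[R]_n.+1,
     [/\ spacelike (linear_part mu A u) = spacelike u,
         timelike (linear_part mu A u) = timelike u
       & null (linear_part mu A u) = null u]) /\
  (forall (k : angle_type) (u v : 'cV[R]_n.+1) (theta : R),
     is_angle k u v theta ->
     is_angle k (linear_part mu A u) (linear_part mu A v) theta /\
     (forall (k' : angle_type) (theta' : R),
        is_angle k' (linear_part mu A u) (linear_part mu A v) theta' ->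
        k' = k /\ theta' = theta)).
Proof.
have [mu0 Apo detA _] := hf.
split=> [u|k u v theta huv].
  by rewrite spacelike_linear_part // timelike_linear_part // null_linear_part.
have hF := is_angle_linear_part mu0 Apo detA huv.
by split=> // k' theta'; exact: is_angle_unique hF.
Qed.
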